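(* Let $\mathcal{P}_N\subset[0,1)^d$, $N=2^m$, be a digital net in base $2$ with generating matrices $C_1,\dots,C_d$, let $p\ge1$, let $c_0,\dots,c_{2^p-1}\in[0,1]$, and let $u\subseteq\{1,\dots,d\}$ be a nonempty coordinate subset. The projected leading-digit pattern of $\mathcal{P}_N$ on $u$ is uniform on $(\mathbb{F}_2^p)^{|u|}$ if and only if $$\operatorname{rank}(A_{p,u})=p|u|.$$ When this condition holds, the transformed rule agrees with the complete product cubature rule on every function depending only on the coordinates in $u$: for every such function $f_u:[0,1]^d\to\mathbb{R}$ one has $Q_{N,p}(f_u)=Q_{p,u}^{\mathrm{prod}}(f_u)$, and hence (for $f_u$ integrable) $$Q_{N,p}(f_u)-I_u(f_u)=Q_{p,u}^{\mathrm{prod}}(f_u)-I_u(f_u).$$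
   Context: Digital net in base $2$: generating matrices $C_1,\dots,C_d\in\mathbb{F}_2^{\mathbb{N}\times m}$ (infinitely many rows, $m$ columns) are given. For $0\le n<N=2^m$ with $n=n_0+2n_1+\cdots+2^{m-1}n_{m-1}$, $n_i\in\{0,1\}$, let $\vec n=(n_0,\dots,n_{m-1})^\top\in\mathbb{F}_2^m$, $\vec y_{n,j}=C_j\vec n=(y_{n,j,1},y_{n,j,2},\dots)^\top\in\mathbb{F}_2^{\mathbb{N}}$ and $x_{n,j}=\sum_{r\ge1}y_{n,j,r}2^{-r}$; the points are $\boldsymbol{x}_n=(x_{n,1},\dots,x_{n,d})\in[0,1)^d$ (as a multiset). It is assumed that no digit sequence $\vec y_{n,j}$ is eventually constantly $1$, so that $(y_{n,j,r})_r$ are the standard binary digits of $x_{n,j}$. Let $C_{j,p}\in\mathbb{F}_2^{p\times m}$ be the first $p$ rows of $C_j$. The linear map $A_p:\mathbb{F}_2^m\to(\mathbb{F}_2^p)^d$ is $A_p(\vec n)=(C_{1,p}\vec n,\dots,C_{d,p}\vec n)$, and $A_{p,u}:\mathbb{F}_2^m\to(\mathbb{F}_2^p)^{|u|}$ is its coordinate projection, $A_{p,u}(\vec n)=(C_{j,p}\vec n)_{j\in u}$. The projected leading-digit pattern on $u$ is the multiset $\{A_{p,u}(\vec n):\vec n\in\mathbb{F}_2^m\}$ of leading $p$-digit vectors of the points in the coordinates of $u$; it is uniform if every element of $(\mathbb{F}_2^p)^{|u|}$ occurs in it with the same multiplicity (frequency $2^{-p|u|}$). For $x\in[0,1)$,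 $I_p(x)=\lfloor2^px\rfloor$ and $T_p(x)=c_{I_p(x)}$; $T_p$ acts coordinate-wise on $[0,1)^d$. The transformed rule is $Q_{N,p}(f)=\frac1N\sum_{n=0}^{N-1}f(T_p(\boldsymbol{x}_n))$. For a function $f_u$ depending only on the coordinates in $u$ (regarded as a function on $[0,1]^{u}$), $Q_{p,u}^{\mathrm{prod}}(f_u)=2^{-p|u|}\sum_{\boldsymbol{a}\in\{0,\dots,2^p-1\}^{u}}f_u\bigl((c_{a_j})_{j\in u}\bigr)$ and $I_u(f_u)=\int_{[0,1]^{u}}f_u$. *)

(* Defs.v *)
From HB Require Import structures.
From mathcomp Require Import all_boot all_order all_algebra.
From mathcomp Require Import all_classical all_reals all_analysis.

Set Implicit Arguments.
Unset Strict Implicit.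
Unset Printing Implicit Defensive.

Import Order.TTheory GRing.Theory Num.Theory.
Import numFieldNormedType.Exports.

Local Open Scope classical_set_scope.
Local Open Scope ring_scope.

(* Lebesgue measure on R^U for a finite index type U: the outer measure is the
   infimum of the total volume of countable covers by boxes, and the measure is
   its restriction to the Caratheodory-measurable sets.  Indexing by U instead
   of 'I_n lets the coordinates of a subset u be used directly. *)
Section lebesgue_outer.
Context (R : realType) (U : finType).

Definition box (c : (U -> R) * (U -> R)) : set (U -> R) :=
  [set x | forall i, c.1 i < x i <= c.2 i].

Definition box_volume (c : (U -> R) * (U -> R)) : R :=
  \prod_i Num.max 0 (c.2 i - c.1 i).

Definition box_cover (A : set (U -> R)) : set (set ((U -> R) * (U -> R))) :=
  [set B | countable B /\ A `<=` \bigcup_(c in B) box c].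

Definition lebesgue_outer (A : set (U -> R)) : \bar R :=
  ereal_inf [set (\esum_(c in B) (box_volume c)%:E)%E | B in box_cover A].

Let box_volume_ge0 c : (0 <= (box_volume c)%:E)%E.
Proof.
by rewrite lee_fin; apply: prodr_ge0 => i _; rewrite le_max lexx.
Qed.

Let lebesgue_outer_ge0 A : (0 <= lebesgue_outer A)%E.
Proof. by apply: le_ereal_inf_tmp => _ [B _ <-]; exact: esum_ge0. Qed.

Let lebesgue_outer0 : lebesgue_outer set0 = 0%E.
Proof.
apply/eqP; rewrite eq_le lebesgue_outer_ge0 andbT.
apply: ereal_inf_lbound; exists set0; last exact: esum_set0.
by split; [exact: countable0|exact: sub0set].
Qed.

Let le_lebesgue_outer : {homo lebesgue_outer : A B / A `<=` B >-> (A <= B)%E}.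
Proof.
move=> A B AB; apply: ereal_inf_le_tmp => _ [C [cC BC] <-].
by exists C => //; split => //; exact: subset_trans BC.
Qed.

Let lebesgue_outer_sigma_subadditive : sigma_subadditive lebesgue_outer.
Proof.
move=> A; have [[i ioo]|] := pselect (exists i, lebesgue_outer (A i) = +oo%E).
  by rewrite (eseries_pinfty _ _ ioo) ?leey// => n _; rewrite -ltNye
    (lt_le_trans _ (lebesgue_outer_ge0 _)).
rewrite -forallNE => Aoo.
apply/lee_addgt0Pr => e e0.
rewrite (le_trans _ (epsilon_trick _ _ (ltW e0)))//.
pose P n B := box_cover (A n) B /\
  (\esum_(c in B) (box_volume c)%:E <=
   lebesgue_outer (A n) + (e / (2 ^ n.+1)%:R)%:E)%E.
have [G PG] : {G : nat -> set ((U -> R) * (U -> R)) & forall n, P n (G n)}.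
  apply: (@choice _ _ P) => n; rewrite /P.
  have en : 0 < e / (2 ^ n.+1)%:R by rewrite divr_gt0// ltr0n expn_gt0.
  have fn : lebesgue_outer (A n) \is a fin_num.
    by rewrite ge0_fin_numE// ltey; apply/eqP; exact: Aoo.
  have [_ [B cB <-] /ltW lB] := lb_ereal_inf_adherent en fn.
  by exists B.
apply: (@le_trans _ _ (\esum_(c in \bigcup_n G n) (box_volume c)%:E)%E).
  apply: ereal_inf_lbound; exists (\bigcup_n G n) => //; split.
    by apply: bigcup_countable => // n _; have [[]] := PG n.
  move=> x [n _ Anx]; have [[_ /(_ _ Anx)[c Gc bc]] _] := PG n.
  by exists c => //; exists n.
rewrite seqDU_bigcup_eq esum_bigcupT; [|exact: trivIset_seqDU|exact: box_volume_ge0].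
rewrite nneseries_esumT; last first.
  by move=> n; rewrite adde_ge0// lee_fin divr_ge0// ltW.
apply: le_esum => n _; apply: le_trans (PG n).2.
apply: ereal_sup_le => _ [X [fX XG] <-]; exists X => //; split => //.
exact: subset_trans XG (@subset_seqDU _ _ _).
Qed.

HB.instance Definition _ := isOuterMeasure.Build R (U -> R) lebesgue_outer
  lebesgue_outer0 lebesgue_outer_ge0 le_lebesgue_outer
  lebesgue_outer_sigma_subadditive.

Definition lebesgue (A : set (caratheodory_type lebesgue_outer)) : \bar R :=
  lebesgue_outer A.

Let lebesgue0 : lebesgue set0 = 0%E.
Proof. exact: lebesgue_outer0. Qed.

Let lebesgue_ge0 A : (0 <= lebesgue A)%E.
Proof. exact: lebesgue_outer_ge0. Qed.

Let lebesgue_sigma_additive : semi_sigma_additive lebesgue.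
Proof. exact: caratheodory_measure_sigma_additive. Qed.

HB.instance Definition _ := isMeasure.Build _ _ _ lebesgue
  lebesgue0 lebesgue_ge0 lebesgue_sigma_additive.

Definition unit_cube : set (U -> R) := [set x | forall i, 0 <= x i <= 1].

Definition integrable_on_cube (g : (U -> R) -> R) : Prop :=
  lebesgue.-integrable unit_cube (EFin \o g).

Definition cube_integral (g : (U -> R) -> R) : R :=
  \int[lebesgue]_(x in unit_cube) g x.

End lebesgue_outer.

Section digital_net.
Context (R : realType) (d m : nat).

(* C j r is the row of index r + 1 of the generating matrix C_j. *)
Variable C : 'I_d -> nat -> 'rV['F_2]_m.

Definition binary_vector (n : nat) : 'cV['F_2]_m :=
  \col_(i < m) (odd (n %/ 2 ^ i))%:R.

(* net_digit n j r is y_{n,j,r+1}. *)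
Definition net_digit (n : nat) (j : 'I_d) (r : nat) : 'F_2 :=
  (C j r *m binary_vector n) 0 0.

(* The digit, an element of F_2 = {0, 1}, is read as a natural number. *)
Definition net_point (n : nat) (j : 'I_d) : R :=
  limn (series (fun r => (net_digit n j r : nat)%:R * 2 ^- r.+1 : R)).

Definition not_eventually_one (y : nat -> 'F_2) : Prop :=
  ~ exists r0, forall r, (r0 <= r)%N -> y r = 1.

Definition leading_rows (p : nat) (j : 'I_d) : 'M['F_2]_(p, m) :=
  \matrix_(r < p) C j r.

Definition leading_digits (p : nat) (v : 'cV['F_2]_m) :
    {ffun 'I_d -> 'cV['F_2]_p} :=
  [ffun j => leading_rows p j *m v].

Definition proj_leading_digits (p : nat) (u : {set 'I_d}) (v : 'cV['F_2]_m) :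
    {ffun {j | j \in u} -> 'cV['F_2]_p} :=
  [ffun j => leading_digits p v (val j)].

Fact proj_leading_digits_is_linear p u : linear (@proj_leading_digits p u).
Proof.
by move=> a v w; apply/ffunP => j; rewrite !ffunE mulmxDr -scalemxAr.
Qed.

HB.instance Definition _ p u :=
  GRing.isLinear.Build _ _ _ _ _ (@proj_leading_digits_is_linear p u).

Definition proj_rank (p : nat) (u : {set 'I_d}) : nat :=
  \dim (limg (linfun (@proj_leading_digits p u))).

(* A multiset is represented by a sequence, count_mem giving multiplicities. *)
Definition projected_pattern (p : nat) (u : {set 'I_d}) :
    seq {ffun {j | j \in u} -> 'cV['F_2]_p} :=
  [seq proj_leading_digits p u v | v : 'cV['F_2]_m].

End digital_net.

Definition uniform_pattern (T : finType) (s : seq T) : Prop :=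
  forall b b' : T, count_mem b s = count_mem b' s.

Section quadrature.
Context (R : realType) (d m p : nat).

Variable c : (2 ^ p).-tuple R.

Definition cell_index (x : R) : nat := `|Num.floor (2 ^+ p * x)|%N.

Definition transform (x : R) : R := nth 0 c (cell_index x).

Definition transformed_rule (C : 'I_d -> nat -> 'rV['F_2]_m)
    (f : ('I_d -> R) -> R) : R :=
  (2 ^ m)%:R^-1 *
  \sum_(n < 2 ^ m) f (fun j => transform (net_point R C n j)).

Definition product_rule (U : finType) (g : (U -> R) -> R) : R :=
  2 ^- (p * #|U|) *
  \sum_(a : {ffun U -> 'I_(2 ^ p)}) g (fun j => tnth c (a j)).

End quadrature.

(* Functions on [0,1]^d are total functions on R^d of which only the values on
   the cube matter. *)
Definition depends_only_on (R : realType) (d : nat) (u : {set 'I_d})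
    (f : ('I_d -> R) -> R) : Prop :=
  forall x y, unit_cube x -> unit_cube y ->
    (forall j, j \in u -> x j = y j) -> f x = f y.

(* f regarded as a function on [0,1]^u: the coordinates outside u, on which it
   does not depend, are set to 0. *)
Definition restrict_to (R : realType) (d : nat) (u : {set 'I_d})
    (f : ('I_d -> R) -> R) (y : {j | j \in u} -> R) : R :=
  f (fun j => oapp y 0 (insub j)).

Arguments restrict_to {R d} u f y.

(* Main.v *)
(** The nonempty fibres of a linear map are translates of its kernel, so the
    values of A_{p,u} are equidistributed exactly when A_{p,u} is onto, that is,
    has full rank.  Since no digit sequence ends in 1s, the tail of the binary
    expansion after p digits is strictly less than 2^-p; hence the cell
    containing x_{n,j} is read off its first p digits, and the transformed rule
    is the average over F_2^m of a function of A_{p,u}.  When A_{p,u} is onto,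
    this is the average of that function over all digit patterns, i.e. the
    product rule. *)
From HB Require Import structures.
Require Import Defs.
From mathcomp Require Import all_boot all_order all_algebra.
From mathcomp Require Import all_classical all_reals all_analysis.
From mathcomp Require Import zify lra.
Import Order.TTheory GRing.Theory Num.Theory.
Local Open Scope ring_scope.

(** * Integers below [2 ^ n] as vectors of binary digits *)

Definition bits_value {n : nat} (v : 'cV['F_2]_n) : nat :=
  \sum_(i < n) (v i 0%R : nat) * 2 ^ i.

Lemma bits_value_binary_vector n k :
  (k < 2 ^ n)%N -> bits_value (binary_vector n k) = k.
Proof.
have bE (b : bool) : (b%:R : 'F_2) = b :> nat by case: b.
rewrite /bits_value; under eq_bigr do rewrite mxE bE.
elim: n k => [|n IHn] k; first by rewrite expn0 big_ord0; case: k.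
rewrite expnS big_ord_recl expn0 divn1 muln1 => ltk.
have ltk2 : (k %/ 2 < 2 ^ n)%N by rewrite ltn_divLR// mulnC.
(* Bit 0 is the parity of [k]; the other bits are those of [k %/ 2], with doubled weights. *)
rewrite [RHS](divn_eq k 2) modn2 addnC -[in RHS](IHn _ ltk2) big_distrl/=.
by congr addn; apply: eq_bigr => i _; rewrite /bump/= add1n expnS divnMA; lia.
Qed.

Lemma card_colF2 n : #|{: 'cV['F_2]_n}| = (2 ^ n)%N.
Proof. by rewrite card_mx card_Fp// muln1. Qed.

Lemma binary_vector_bij n : bijective (fun k : 'I_(2 ^ n) => binary_vector n k).
Proof.
apply: inj_card_bij; last by rewrite card_colF2 card_ord.
move=> k l /(congr1 bits_value).
by rewrite !bits_value_binary_vector// => kl; apply: val_inj.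
Qed.

(** Surjectivity of [binary_vector] gives the bound: [v] is the vector of an index already below
    [2 ^ n]. *)
Lemma bits_value_lt n (v : 'cV['F_2]_n) : (bits_value v < 2 ^ n)%N.
Proof.
by have [g _ gK] := binary_vector_bij n; rewrite -(gK v) bits_value_binary_vector.
Qed.

Lemma binary_vectorK n (v : 'cV['F_2]_n) : binary_vector n (bits_value v) = v.
Proof.
have [g _ gK] := binary_vector_bij n.
by rewrite -(gK v) bits_value_binary_vector.
Qed.

Definition rev_digits {p : nat} (w : 'cV['F_2]_p) : 'cV['F_2]_p :=
  \col_(r < p) w (rev_ord r) 0.

Lemma rev_digitsK p : involutive (@rev_digits p).
Proof.
by move=> w; apply/colP => r; rewrite !mxE rev_ordK.
Qed.

(* Leading digits are listed most significant first, hence the reversal. *)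
Definition digit_cell {p : nat} (w : 'cV['F_2]_p) : 'I_(2 ^ p) :=
  Ordinal (bits_value_lt p (rev_digits w)).

Lemma digit_cell_bij p : bijective (@digit_cell p).
Proof.
exists (fun a : 'I_(2 ^ p) => rev_digits (binary_vector p a)) => [w|a].
  by rewrite binary_vectorK rev_digitsK.
by apply: val_inj; rewrite /= rev_digitsK bits_value_binary_vector.
Qed.

Lemma digit_cellE p (w : 'cV['F_2]_p) :
  digit_cell w = (\sum_(r < p) (w r 0%R : nat) * 2 ^ (p - r.+1))%N :> nat.
Proof.
rewrite /= /bits_value (reindex_inj rev_ord_inj)/=.
by apply: eq_bigr => r _; rewrite mxE rev_ordK.
Qed.

Lemma digitF2_le1 (x : 'F_2) : (x <= 1)%N.
Proof. by rewrite -ltnS; exact: ltn_ord x. Qed.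

(** * Binary expansions and the cell of their limit *)

Section binary_expansion.
Import numFieldNormedType.Exports.
Local Open Scope classical_set_scope.
Local Open Scope ring_scope.
Context (R : realType) (y : nat -> 'F_2).

Let s : R^nat := series (fun r => (y r : nat)%:R * 2 ^- r.+1).

Lemma binary_series_le : {homo s : n k / (n <= k)%N >-> n <= k}.
Proof.
apply/nondecreasing_seqP => n.
by rewrite /s !seriesEnat/= big_nat_recr//= lerDl mulr_ge0// invr_ge0 exprn_ge0.
Qed.

(** The extreme case is a block of digits 1, a geometric sum. Keeping the term [2 ^- n] lets the
    induction close. *)
Lemma binary_series_tail p n :
  (p <= n)%N -> s n <= s p + 2 ^- p - 2 ^- n.
Proof.
elim: n => [|n IHn]; first by rewrite leqn0 => /eqP->; lra.
rewrite leq_eqVlt => /predU1P[->|]; first by lra.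
rewrite ltnS => /IHn le_n; rewrite {1}/s seriesEnat/= big_nat_recr//=.
have -> : \sum_(0 <= i < n) (y i : nat)%:R * 2 ^- i.+1 = s n.
  by rewrite /s seriesEnat.
have y1 : (y n : nat)%:R * 2 ^- n.+1 <= 2 ^- n.+1 :> R.
  by rewrite ler_piMl ?invr_ge0 ?exprn_ge0// lern1 digitF2_le1.
have h2 : 2 ^- n = 2 * 2 ^- n.+1 :> R.
  by rewrite exprS invfM mulrA divff ?mul1r// pnatr_eq0.
lra.
Qed.

(** The gap [e] does not depend on [n], so it survives the passage to the limit, where a bare strict
    inequality would become weak. *)
Lemma binary_series_tail_lt p :
  not_eventually_one y ->
  exists2 e : R, 0 < e & \forall n \near \oo, s n <= s p + 2 ^- p - e.
Proof.
move=> y1; have [r pr yr0] : exists2 r, (p <= r)%N & y r = 0.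
  apply: contrapT => H; apply: y1; exists p => r pr.
  have : y r <> 0 by move=> yr0; apply: H; exists r.
  case: (y r) => -[|[|//]] lt2 y0; last exact: val_inj.
  by case: y0; apply: val_inj.
(* This is the weight of the zero digit at index [r]: the tail falls short of [2 ^- p] by at least
   this amount. *)
exists (2 ^- r.+1); first by rewrite invr_gt0 exprn_gt0.
near=> n; have rn : (r.+1 <= n)%N by near: n; exact: nbhs_infty_ge.
have := binary_series_tail _ _ rn; have := binary_series_tail _ _ pr.
have -> : s r.+1 = s r.
  by rewrite /s !seriesEnat/= big_nat_recr//= yr0 mul0r addr0.
have -> : 2 ^- r = 2 * 2 ^- r.+1 :> R.
  by rewrite exprS invfM mulrA divff ?mul1r// pnatr_eq0.
have : 0 <= 2 ^- n :> R by rewrite invr_ge0 exprn_ge0.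
lra.
Unshelve. all: by end_near. Qed.

(** Scaling by [2 ^+ p] turns [s p] into an integer, and the limit lies in [[s p, s p + 2 ^- p)], so
    that integer is the floor. *)
Lemma cell_index_binary_series p : not_eventually_one y ->
  cell_index p (limn s) = (\sum_(r < p) (y r : nat) * 2 ^ (p - r.+1))%N.
Proof.
move=> y1; have cs : cvgn s.
  apply: nondecreasing_is_cvgn; first exact: binary_series_le.
  (* The bound 1 is the tail estimate started at the empty partial sum [s 0]. *)
  exists 1 => _ [n _ <-]; have := binary_series_tail _ _ (leq0n n).
  rewrite /s {2}seriesEnat/= big_geq// expr0 invr1 add0r => /le_trans; apply.
  by rewrite gerBl invr_ge0 exprn_ge0.
have lb : s p <= limn s.
  by apply: nondecreasing_cvgn_le => //; exact: binary_series_le.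
have [e e0 Me] := binary_series_tail_lt p y1.
have ub : limn s <= s p + 2 ^- p - e by exact: limr_le.
set K := (RHS).
have sK : 2 ^+ p * s p = K%:R :> R.
  rewrite /s seriesEnat/= big_mkord mulr_sumr /K natr_sum.
  apply: eq_bigr => r _; rewrite mulrCA natrM natrX; congr (_ * _).
  by rewrite expfB_cond// pnatr_eq0 ltn_ord.
rewrite /cell_index (@floor_def _ _ K%:Z)//.
have p0 : 0 < 2 ^+ p :> R by rewrite exprn_gt0.
have pV : 2 ^+ p * 2 ^- p = 1 :> R by rewrite divff// gt_eqF.
rewrite intrD -pmulrn -sK; apply/andP; split; first by rewrite ler_pM2l.
have : 2 ^+ p * limn s < 2 ^+ p * (s p + 2 ^- p) by rewrite ltr_pM2l//; lra.
by rewrite mulrDr pV.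
Qed.

End binary_expansion.

(** * Fibres and averages of additive maps between finite groups *)

Section additive_fibres.
Context (V W : finZmodType) (g : {additive V -> W}).

Lemma card_additive_fibre v0 :
  #|[pred v | g v == g v0]| = #|[pred v | g v == 0]|.
Proof.
rewrite -[RHS](card_imset _ (addIr v0)); apply: eq_card => v.
rewrite [LHS]inE; apply/idP/finset.imsetP => [/eqP gv|[x + ->]].
  by exists (v - v0); rewrite ?subrK// inE raddfB gv subrr.
by rewrite inE raddfD => /eqP->; rewrite add0r.
Qed.

Lemma uniform_patternP :
  uniform_pattern (codom g) <-> forall b, exists v, g v = b.
Proof.
have cntE b : count_mem b (codom g) = #|[pred v | g v == b]|.
  rewrite count_map cardE -size_filter enumT /enum_mem.
  by rewrite (eq_filter (a2 := preim g (pred1 b))).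
split=> [unif b|surj b b']; last first.
  have [v <-] := surj b; have [v' <-] := surj b'.
  by rewrite !cntE !card_additive_fibre.
(* The value 0 is always attained, at [g 0]; equal multiplicities then force every [b] to be
   attained. *)
have : (0 < count_mem b (codom g))%N.
  rewrite (unif b 0) -has_count; apply/hasP; exists (g 0); last by rewrite /= raddf0.
  exact: codom_f.
by rewrite -has_count => /hasP[_ /codomP[v ->]] /= /eqP <-; exists v.
Qed.

Lemma average_surjective_additive (R : numFieldType) (h : W -> R) :
  (forall b, exists v, g v = b) ->
  #|V|%:R^-1 * \sum_v h (g v) = #|W|%:R^-1 * \sum_b h b.
Proof.
move=> surj; pose k := #|[pred v | g v == 0]|.
have sumE (h' : W -> R) : \sum_v h' (g v) = k%:R * \sum_b h' b.
  rewrite (partition_big g predT)//= mulr_sumr; apply: eq_bigr => b _.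
  rewrite (eq_bigr (fun=> h' b)) => [|v /eqP-> //].
  have [v0 <-] := surj b.
  by rewrite sumr_const card_additive_fibre mulr_natl.
(* Summing the constant 1 over fibres of size [k] counts [V]. *)
have cardV : #|V|%:R = k%:R * #|W|%:R :> R.
  by have := sumE (fun=> 1); rewrite !sumr_const.
have k0 : k%:R != 0 :> R.
  rewrite pnatr_eq0 -lt0n; apply/card_gt0P; exists 0.
  by rewrite inE raddf0.
by rewrite sumE cardV invfM [k%:R^-1 * _]mulrC -mulrA mulKf.
Qed.

End additive_fibres.

(* Both factors of the join exist already; this only makes HB register it. *)
HB.instance Definition _ (I : finType) (V : finZmodType) :=
  Finite.on {ffun I -> V}.

(** * Rank of the digit map and the cubature rules *)

Lemma proj_rankE (d m p : nat) (C : 'I_d -> nat -> 'rV['F_2]_m) (u : {set 'I_d}) :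
  proj_rank C p u = (p * #|u|)%N <->
  forall b, exists v, proj_leading_digits C p u v = b.
Proof.
set g := proj_leading_digits C p u; rewrite /proj_rank -/g.
have -> : (p * #|u|)%N = \dim {: {ffun {j | j \in u} -> 'cV['F_2]_p}}%VS.
  rewrite dimvf [dim _](_ : _ = #|{: {j | j \in u}}| * dim 'cV['F_2]_p)%N//.
  by rewrite dim_matrix mulr1 mulnC card_sig.
split=> [dimE b|surj].
  (* A subspace of full dimension is the whole space. *)
  have /eqP imE : limg (linfun g) == fullv by rewrite eqEdim subvf dimE leqnn.
  have /memv_imgP[v _ ->] : b \in limg (linfun g) by rewrite imE memvf.
  by exists v; rewrite lfunE.
congr (\dim _); apply/eqP; rewrite eqEsubv subvf; apply/subvP => b _.
by have [v <-] := surj b; rewrite -[g v](lfunE g) memv_img ?memvf.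
Qed.

Lemma transform_net_point (R : realType) (d m p : nat)
    (C : 'I_d -> nat -> 'rV['F_2]_m) (c : (2 ^ p).-tuple R) (n : nat) (j : 'I_d) :
  not_eventually_one (net_digit C n j) ->
  transform c (net_point R C n j) =
  tnth c (digit_cell (leading_rows C p j *m binary_vector m n)).
Proof.
move=> y1; rewrite /transform /net_point cell_index_binary_series//.
rewrite (tnth_nth 0) digit_cellE; congr (nth 0 c _).
apply: eq_bigr => r _; congr (_ * _)%N; congr nat_of_ord.
by rewrite /net_digit !mxE; apply: eq_bigr => k _; rewrite [leading_rows _ _ _ _ _]mxE.
Qed.

Lemma transformed_rule_product (R : realType) (d m p : nat)
    (C : 'I_d -> nat -> 'rV['F_2]_m) (c : (2 ^ p).-tuple R) (u : {set 'I_d})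
    (f : ('I_d -> R) -> R) :
  (forall (n : 'I_(2 ^ m)) (j : 'I_d), not_eventually_one (net_digit C n j)) ->
  (forall a : 'I_(2 ^ p), 0 <= tnth c a <= 1) ->
  (forall b, exists v, proj_leading_digits C p u v = b) ->
  depends_only_on u f ->
  transformed_rule c C f = product_rule c (restrict_to u f).
Proof.
move=> hC hc surj fu; pose U : finType := {j | j \in u}.
pose h (b : {ffun U -> 'cV['F_2]_p}) :=
  restrict_to u f (fun j => tnth c (digit_cell (b j))).
have -> : transformed_rule c C f =
    (2 ^ m)%:R^-1 * \sum_v h (proj_leading_digits C p u v).
  rewrite /transformed_rule (reindex _ (onW_bij _ (binary_vector_bij m)))/=.
  (* [fu] compares points of the cube only: [hc] places the transformed point there, and the padding
     value 0 keeps the restricted one inside. *)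
  congr (_ * _); apply: eq_bigr => n _; apply: fu => [j|j|j ju].
  - by rewrite transform_net_point.
  - by case: insub => [i|] /=; rewrite ?lexx ?ler01.
  - by rewrite insubT/= transform_net_point// !ffunE.
rewrite -card_colF2.
rewrite [LHS](average_surjective_additive _ _ (proj_leading_digits C p u))//.
rewrite card_ffun card_colF2 card_sig -expnM /product_rule card_sig natrX.
congr (_ * _).
have [e' eK e'K] := digit_cell_bij p.
(* Applying [digit_cell] in each coordinate matches digit patterns bijectively with the index tuples
   of the product rule. *)
rewrite [RHS](reindex (fun b : {ffun U -> 'cV['F_2]_p} =>
  [ffun j => digit_cell (b j)] : {ffun U -> 'I_(2 ^ p)})) /=; last first.
  exists (fun a : {ffun U -> 'I_(2 ^ p)} => [ffun j => e' (a j)]) => a _;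
  by apply/ffunP => j; rewrite !ffunE ?eK ?e'K.
by apply: eq_bigr => b _; congr restrict_to; apply: funext => j; rewrite ffunE.
Qed.

Theorem proposition3p1 (R : realType) (d m p : nat)
    (C : 'I_d -> nat -> 'rV['F_2]_m)
    (hC : forall (n : 'I_(2 ^ m)) (j : 'I_d),
        not_eventually_one (net_digit C n j))
    (hp : (1 <= p)%N)
    (c : (2 ^ p).-tuple R)
    (hc : forall a : 'I_(2 ^ p), 0 <= tnth c a <= 1)
    (u : {set 'I_d}) (hu : u != finset.set0) :
  (uniform_pattern (projected_pattern C p u) <->
     proj_rank C p u = (p * #|u|)%N) /\
  (proj_rank C p u = (p * #|u|)%N ->
   forall f : ('I_d -> R) -> R, depends_only_on u f ->
     transformed_rule c C f = product_rule c (restrict_to u f) /\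
     (integrable_on_cube (restrict_to u f) ->
        transformed_rule c C f - cube_integral (restrict_to u f) =
        product_rule c (restrict_to u f) - cube_integral (restrict_to u f))).
Proof.
split; first by rewrite proj_rankE; exact: uniform_patternP.
move=> /proj_rankE surj f fu.
have Qf : transformed_rule c C f = product_rule c (restrict_to u f).
  exact: transformed_rule_product.
by split=> // _; rewrite Qf.
Qed.
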